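(* Let $V$ be a finite set with $v=|V|\ge1$, let $1\le k\le v$, and let $H$ be a finite set with $h=|H|$. If $$h\ \ge\ U(v,k):=\sum_{j=2}^kD(v,j),$$ then every distribution from the $k$-interaction model $\mathcal{E}_{S_k}$ on $\{0,1\}^V$ can be approximated arbitrarily well by distributions from $\mathrm{RBM}_{V,H}$. Here $D(v,j)\le\frac{1+\log(v-j+1)}{v-j+1}\binom{v}{j}$ and $D(v,j)\le\binom{v-1}{j-1}$ for $0<j\le v$. In particular, the approximation conclusion holds whenever $h\ge\sum_{j=2}^k\binom{v-1}{j-1}$, or ($v\ge2$ and) $h\ge\frac{\log(v-1)+1}{v+1}\sum_{j=2}^k\binom{v+1}{j}$.
   Context: $\log$ denotes the natural logarithm. $k$-interaction model: with $S_k=\{\Lambda\subseteq V:|\Lambda|\le k\}$, $\mathcal{E}_{S_k}$ is the set of probability distributions on $\{0,1\}^V$ of the form $p(x)=\frac{1}{Z}\exp\big(\sum_{\Lambda\in S_k}J_\Lambda\prod_{i\in\Lambda}x_i\big)$ with arbitrary $J_\Lambda\in\mathbb{R}$, where $Z$ is the normalizing constant. Restricted Boltzmann machine: $\mathrm{RBM}_{V,H}$ is the set of probability distributions on $\{0,1\}^V$ of the form $p(x)=\frac1Z\exp(F(x))$ with $$F(x)=\sum_{i\in V}b_ix_i+\sum_{j\in H}\log\Big(1+\exp\Big(\sum_{i\in V}w_{ji}x_i+c_j\Big)\Big),$$ where $b_i,w_{ji},c_j\in\mathbb{R}$ are arbitrary and $Z$ is the normalizing constant. A distribution $p$ can be approximated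 arbitrarily well by distributions from a model $\mathcal{M}$ if for every $\epsilon>0$ there is $q\in\mathcal{M}$ with $\max_x|p(x)-q(x)|\le\epsilon$. A star tuple is a set of the form $\{B\cup\{j\}: j\in B'\}$ with $B,B'\subseteq V$ and $B\cap B'=\emptyset$. $D(v,j)$ is the smallest number of star tuples whose union contains $\binom{V}{j}=\{\Lambda\subseteq V:|\Lambda|=j\}$. Empty sums are $0$. *)

(* Defs.v *)
From mathcomp Require Import all_boot all_order all_algebra.
From mathcomp Require Import reals sequences exp.

Set Implicit Arguments.
Unset Strict Implicit.
Unset Printing Implicit Defensive.

Import Order.TTheory GRing.Theory Num.Theory.

Section Models.
Local Open Scope ring_scope.
Variable R : realType.

Definition config (V : finType) : finType := {ffun V -> bool}.

Definition gibbs (V : finType) (E : config V -> R) (x : config V) : R :=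
  expR (E x) / \sum_(y : config V) expR (E y).

Definition interaction_energy (V : finType) (k : nat) (J : {set V} -> R)
    (x : config V) : R :=
  \sum_(L : {set V} | (#|L| <= k)%N) J L * \prod_(i in L) (x i)%:R.

Definition interaction_model (V : finType) (k : nat) (p : config V -> R) : Prop :=
  exists J : {set V} -> R, forall x, p x = gibbs (interaction_energy k J) x.

Definition rbm_energy (V H : finType) (b : V -> R) (w : H -> V -> R)
    (c : H -> R) (x : config V) : R :=
  \sum_(i : V) b i * (x i)%:R
  + \sum_(j : H) ln (1 + expR (\sum_(i : V) w j i * (x i)%:R + c j)).

Definition rbm (V H : finType) (p : config V -> R) : Prop :=
  exists (b : V -> R) (w : H -> V -> R) (c : H -> R),
    forall x, p x = gibbs (rbm_energy b w c) x.

(* Starting the maximum at 0 is harmless: the terms are nonnegative. *)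
Definition approximable (V : finType) (M : (config V -> R) -> Prop)
    (p : config V -> R) : Prop :=
  forall eps : R, 0 < eps ->
    exists2 q, M q & \big[Num.max/0]_(x : config V) `|p x - q x| <= eps.

End Models.

Section StarTuples.
Local Open Scope nat_scope.

Definition star_tuple (V : finType) (F : {set {set V}}) : bool :=
  [exists B : {set V}, exists B' : {set V},
    (B :&: B' == set0) && (F == [set j |: B | j in B'])].

Definition layer (V : finType) (j : nat) : {set {set V}} :=
  [set L : {set V} | #|L| == j].

Definition star_covering (V : finType) (j : nat) (S : {set {set {set V}}}) : bool :=
  [forall F in S, star_tuple F] && (layer V j \subset cover S).

(* D(v, j) for v = #|V|; it depends on V only through #|V|
   (eq_card_star_number).  The family of all star tuples is the default of the
   arg min: it is a covering as soon as 0 < j (see star_numberP).  For j = 0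
   there is no covering, since star tuples have only nonempty members, and the
   value is meaningless. *)
Definition star_number (V : finType) (j : nat) : nat :=
  #|[arg min_(S < [set F : {set {set V}} | star_tuple F] | star_covering j S) #|S| ]|.

Definition star_bound (V : finType) (k : nat) : nat :=
  \sum_(2 <= j < k.+1) star_number V j.

Lemma star_covering_all (V : finType) (j : nat) :
  0 < j -> star_covering j [set F : {set {set V}} | star_tuple F].
Proof.
move=> j0; apply/andP; split; first by apply/forall_inP => F; rewrite inE.
apply/subsetP => L; rewrite inE => /eqP cL.
have /card_gt0P[i iL] : 0 < #|L| by rewrite cL.
apply/bigcupP; exists [set L]; last by rewrite inE.
rewrite inE; apply/existsP; exists (L :\ i); apply/existsP; exists [set i].
apply/andP; split.
  by apply/eqP/setP => a; rewrite !inE; case: (a == i); rewrite ?andbF.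
by apply/eqP; rewrite imset_set1 setD1K.
Qed.

Lemma star_numberP (V : finType) (j : nat) : 0 < j ->
  (exists2 S : {set {set {set V}}}, star_covering j S & #|S| = star_number V j) /\
  (forall S : {set {set {set V}}}, star_covering j S -> star_number V j <= #|S|).
Proof.
move=> j0; rewrite /star_number.
case: arg_minnP => [|S cS minS]; first exact: star_covering_all.
by split; first by exists S.
Qed.

Lemma eq_card_star_number (V W : finType) (j : nat) :
  0 < j -> #|V| = #|W| -> star_number V j = star_number W j.
Proof.
move=> j0; suff main (V' W' : finType) : #|V'| = #|W'| -> star_number V' j <= star_number W' j.
  by move=> eVW; apply/eqP; rewrite eqn_leq !main.
move=> {V W}; move: V' W' => V W eVW.
have [[S /andP[/forall_inP sS cS] <-] _] := star_numberP W j0.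
have [_ minV] := star_numberP V j0.
pose f (y : W) : V := enum_val (cast_ord (esym eVW) (enum_rank y)).
pose g (x : V) : W := enum_val (cast_ord eVW (enum_rank x)).
have fK : cancel f g.
  by move=> y; rewrite /f /g enum_valK cast_ordKV enum_rankK.
have gK : cancel g f.
  by move=> x; rewrite /f /g enum_valK cast_ordK enum_rankK.
have finj := can_inj fK.
pose h (F : {set {set W}}) : {set {set V}} := [set f @: (L : {set W}) | L in F].
apply: leq_trans (leq_imset_card h S); apply: minV; apply/andP; split.
  apply/forall_inP => G /imsetP[F FS ->] {G}.
  have /existsP[B /existsP[B' /andP[/eqP dB /eqP ->]]] := sS F FS.
  apply/existsP; exists (f @: B); apply/existsP; exists (f @: B').
  rewrite -(imsetI (in2W finj)) dB imset0 eqxx /=.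
  rewrite /h -!imset_comp; apply/eqP/eq_imset => y /=.
  by rewrite imsetU1.
apply/subsetP => L; rewrite inE => /eqP cL.
have /(subsetP cS)/bigcupP[F FS LF] : g @: L \in layer W j.
  by rewrite inE card_imset ?cL //; exact: can_inj gK.
apply/bigcupP; exists (h F); first exact: imset_f.
apply/imsetP; exists (g @: L) => //.
by rewrite -imset_comp (eq_imset _ gK) imset_id.
Qed.

End StarTuples.

(* Main.v *)
Require Import Defs.
From mathcomp Require Import all_boot all_order all_algebra.
From mathcomp Require Import reals sequences exp.
From mathcomp Require Import lra ring zify.

(** Up to an additive constant, which normalization absorbs, the energy of a
    restricted Boltzmann machine is a linear form in x plus one softplus
    ln (1 + e^s) of an affine form s for each hidden unit.  Normalization is
    continuous in the energy for the uniform norm ([gibbs_continuous]), so it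
    is enough to approximate energies uniformly.

    Softplus is close to 0 at very negative arguments and close to the identity
    at large ones.  Hence a unit that receives a huge positive weight from every
    vertex of a set B, and a bias that just compensates all of them, is silent
    unless x is 1 on all of B, and is affine otherwise: it computes
      (prod_(i in B) x_i) * (c + sum_i a_i x_i)
    up to any prescribed error, with arbitrary a_i ([hidden_unit_star]).  Thus
    one unit realizes arbitrary interactions on all the sets B + i of a star
    tuple, at the price of an unwanted interaction c on the smaller set B.  One
    therefore treats the interactions by decreasing order: all those of order j
    are removed with as many units as there are star tuples in a covering of the
    sets of size j, and the side effects have order j - 1
    ([unit_approximable_layer]).  Once the order is 1, what is left is an affine
    function, which needs no hidden unit.

    The bounds on the number of star tuples come from two coverings.  The stars
    centred at the (j-1)-sets that avoid a fixed vertex v0 cover all j-sets: a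
    j-set L is reached from L - v0 if v0 is in L, and from any L - i otherwise;
    this gives the binomial bound ([star_number_le_bin]).  For the logarithmic
    bound, every j-set lies in j of the stars centred at (j-1)-sets and each
    star has d = v - j + 1 members, so weight 1/j on each star is a fractional
    covering of total weight C(v, j-1) / j = C(v, j) / d; a greedy choice of
    stars loses at most the factor 1 + 1/2 + ... + 1/d <= 1 + ln d
    ([greedy_cover], [star_number_le_ln]).  The last bound on the number of
    hidden units follows from it, since v - j + 1 <= v - 1 for j >= 2 and
    C(v, j) / (v - j + 1) = C(v + 1, j) / (v + 1). *)

Set Implicit Arguments.
Unset Strict Implicit.
Unset Printing Implicit Defensive.

Import Order.TTheory GRing.Theory Num.Theory.

Local Open Scope ring_scope.

(** * Softplus units and single star tuples *)

Section HiddenUnits.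
Variable R : realType.

Definition softplus (s : R) : R := ln (1 + expR s).

Lemma softplus_ge0 s : 0 <= softplus s.
Proof. by rewrite ln_ge0 // lerDl expR_ge0. Qed.

Lemma softplus_le_expR s : softplus s <= expR s.
Proof. by apply: le_ln1Dx; rewrite (lt_trans _ (expR_gt0 s)) // oppr_lt0. Qed.

(** The identity plus a correction that is exponentially small for large [s],
    by [softplus_le_expR]. *)
Lemma softplusN s : softplus s = s + softplus (- s).
Proof.
rewrite /softplus -{2}(expRK s) -lnM ?posrE ?expR_gt0 ?addr_gt0 ?expR_gt0 //.
by rewrite mulrDr mulr1 -expRD subrr expR0 addrC.
Qed.

Lemma expRN_small (d : R) : 0 < d -> exists2 t, 0 <= t & expR (- t) <= d.
Proof.
move=> d0; exists d^-1; first by rewrite invr_ge0 ltW.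
rewrite expRN -[leRHS]invrK lef_pV2 ?posrE ?invr_gt0 ?expR_gt0 //.
by apply: le_trans (expR_ge1Dx _); rewrite lerDr.
Qed.

Variable V : finType.
Implicit Types (B L : {set V}) (x : config V) (J : {set V} -> R).

Definition monomial L x : R := \prod_(i in L) (x i)%:R.

Lemma monomialE L x : monomial L x = [forall i in L, x i]%:R.
Proof.
rewrite /monomial; case: (boolP [forall i in L, x i]) => [/forall_inP h|].
  by rewrite big1 // => i /h ->.
rewrite negb_forall_in => /exists_inP[i iL /negbTE xi].
by rewrite (bigD1 i) //= xi mul0r.
Qed.

Definition linear_form (a : V -> R) x : R := \sum_i a i * (x i)%:R.

Definition hidden_unit (u : (V -> R) * R) x : R :=
  softplus (linear_form u.1 x + u.2).

Lemma linear_form_bound (a : V -> R) x : `|linear_form a x| <= \sum_i `|a i|.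
Proof.
apply: le_trans (ler_norm_sum _ _ _) _; apply: ler_sum => i _.
by rewrite normrM; case: (x i); rewrite ?normr1 ?normr0 ?mulr1 ?mulr0.
Qed.

(** The weights are those of [a], increased by a gate weight [w] on [B]; the
    bias [c - w * #|B|] makes the gate contribute exactly 0 when [x] is 1 on
    [B], and at most [- w] otherwise.  The constant [c] keeps an open unit in
    the range where softplus is nearly the identity, and [w] is large enough to push a
    closed unit into the range where softplus is nearly 0. *)
Lemma hidden_unit_star B (a : V -> R) (d : R) : 0 < d ->
  exists u, exists c, forall x,
    `|hidden_unit u x - monomial B x * (c + linear_form a x)| <= d.
Proof.
move=> d0; have [t t0 td] := expRN_small d0.
pose A := \sum_i `|a i|.
have A0 : 0 <= A by apply: sumr_ge0.
pose c := A + t; pose w := A + c + t.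
exists (fun i => a i + w * (i \in B)%:R, c - w * #|B|%:R), c => x.
have -> : hidden_unit (fun i => a i + w * (i \in B)%:R, c - w * #|B|%:R) x =
    softplus (c + linear_form a x - w * (#|B|%:R - \sum_(i in B) (x i)%:R)).
  rewrite /hidden_unit /linear_form /=; congr softplus.
  rewrite (eq_bigr (fun i => a i * (x i)%:R + w * ((i \in B)%:R * (x i)%:R))).
    rewrite big_split /= -mulr_sumr.
    have -> : \sum_i (i \in B)%:R * (x i)%:R = \sum_(i in B) (x i)%:R :> R.
      rewrite [RHS]big_mkcond; apply: eq_bigr => i _.
      by case: (i \in B); rewrite ?mul1r ?mul0r.
    by ring.
  by move=> i _; rewrite mulrDl mulrA.
have /ler_normlP[lo hi] := linear_form_bound a x; rewrite -/A in lo hi.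
(* Either the gate is open, or some vertex of [B] is 0 and it is closed. *)
rewrite monomialE; case: forall_inP => [allB|someB].
  rewrite (eq_bigr (fun=> 1)); last by move=> i /allB ->.
  rewrite sumr_const subrr mulr0 subr0 mul1r softplusN addrAC subrr add0r.
  rewrite ger0_norm ?softplus_ge0 //; apply: le_trans (softplus_le_expR _) _.
  by apply: le_trans td; rewrite ler_expR lerN2 /c; lra.
rewrite mul0r subr0 ger0_norm ?softplus_ge0 //.
apply: le_trans (softplus_le_expR _) _; apply: le_trans td; rewrite ler_expR.
have gap : 1 <= #|B|%:R - \sum_(i in B) (x i)%:R :> R.
  have /forall_inPn[i iB /negbTE xi] : ~~ [forall i in B, x i].
    by apply/forall_inP.
  rewrite -[#|B|%:R]sumr_const -sumrB (bigD1 i) //= xi subr0 lerDl.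
  by apply: sumr_ge0 => l _; case: (x l); rewrite ?subrr ?subr0.
have : w * 1 <= w * (#|B|%:R - \sum_(i in B) (x i)%:R).
  by rewrite ler_wpM2l // /w /c; lra.
by rewrite {1}/w /c; lra.
Qed.

(** Energies in the uniform closure of those of machines with at most [n] hidden
    units; the free constant [b0] is invisible after normalization. *)
Definition unit_approximable (n : nat) (E : config V -> R) : Prop :=
  forall d : R, 0 < d -> exists b b0 (us : seq ((V -> R) * R)),
    (size us <= n)%N /\
    forall x, `|E x - (b0 + linear_form b x + \sum_(u <- us) hidden_unit u x)|
      <= d.

Lemma eq_unit_approximable n E E' :
  E =1 E' -> unit_approximable n E -> unit_approximable n E'.
Proof.
move=> eE aE d /aE[b [b0 [us [sz h]]]]; exists b, b0, us; split=> // x.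
by rewrite -eE.
Qed.

Lemma unit_approximableW n m E :
  (n <= m)%N -> unit_approximable n E -> unit_approximable m E.
Proof.
move=> nm aE d /aE[b [b0 [us [sz h]]]]; exists b, b0, us; split=> //.
exact: leq_trans nm.
Qed.

(** One unit pays for arbitrary interactions on a whole star.  The hypothesis is
    required for every [c] because the constant produced by [hidden_unit_star]
    depends on the precision. *)
Lemma unit_approximable_peel n B a E :
  (forall c, unit_approximable n (fun x => E x + c * monomial B x)) ->
  unit_approximable n.+1 (fun x => E x + monomial B x * linear_form a x).
Proof.
move=> aE d d0; have d20 : 0 < d / 2 by rewrite divr_gt0.
have [u [c hu]] := hidden_unit_star B a d20.
have [b [b0 [us [sz h]]]] := aE (- c) _ d20.
exists b, b0, (u :: us); split=> // x; rewrite big_cons.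
have := h x; have := hu x; rewrite !ler_norml => /andP[h1 h2] /andP[h3 h4].
by apply/andP; split; lra.
Qed.

(** * Removing the interactions layer by layer *)

Definition set_energy J x : R := \sum_L J L * monomial L x.

Lemma set_energyD J J' x :
  set_energy (fun L => J L + J' L) x = set_energy J x + set_energy J' x.
Proof. by rewrite -big_split; apply: eq_bigr => L _; rewrite mulrDl. Qed.

Lemma set_energy1 B c x :
  set_energy (fun L => c *+ (L == B)) x = c * monomial B x.
Proof.
rewrite /set_energy (bigD1 B) //= eqxx mulr1n big1 ?addr0 // => L /negbTE ->.
by rewrite mulr0n mul0r.
Qed.

Definition star B (B' : {set V}) : {set {set V}} := [set i |: B | i in B'].

Lemma set_energy_star B B' J x : B :&: B' = set0 ->
  set_energy (fun L => J L *+ (L \in star B B')) x =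
  monomial B x * linear_form (fun i => J (i |: B) *+ (i \in B')) x.
Proof.
move=> dis; have out i : i \in B' -> i \notin B.
  by move=> iB'; apply/negP => iB; have := in_set0 i; rewrite -dis !inE iB iB'.
rewrite /set_energy (bigID [in star B B']) /=.
rewrite [X in _ + X]big1 ?addr0; last first.
  by move=> L /negbTE ->; rewrite mul0r.
rewrite big_imset /=; last first.
  move=> i l /out iB /out lB /setP/(_ i).
  by rewrite !inE eqxx (negbTE iB) /= orbF => /esym/eqP.
rewrite /linear_form mulr_sumr [RHS](bigID [in B']) /= [X in _ + X]big1 ?addr0.
  apply: eq_bigr => i iB'; rewrite iB' /monomial.
  have -> : i |: B \in star B B' by exact: imset_f.
  rewrite !mulr1n.
  by rewrite big_setU1 ?out //= [RHS]mulrCA mulrA mulrAC -mulrA.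
by move=> i /negbTE ->; rewrite mul0r mulr0.
Qed.

(** The star tuples of a covering are removed one at a time, each with one
    hidden unit; as an interaction disappears together with the first star tuple
    that contains it, overlaps between star tuples are harmless.  The support
    condition says that every interaction of the top order [j] still lies in a
    remaining star tuple. *)
Lemma unit_approximable_layer (n j : nat) : (0 < j)%N ->
  (forall J, (forall L, J L != 0 -> (#|L| < j)%N) ->
     unit_approximable n (set_energy J)) ->
  forall S : seq {set {set V}}, all (@star_tuple V) S ->
  forall J,
    (forall L, J L != 0 -> (#|L| < j)%N ||
       (#|L| == j) && has (fun F : {set {set V}} => L \in F) S) ->
  unit_approximable (n + size S) (set_energy J).
Proof.
move=> j0 base; elim=> [|F S IH] /= allS J supJ.
  by rewrite addn0; apply: base => L /supJ; rewrite andbF orbF.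
have /andP[/existsP[B /existsP[B' /andP[/eqP dis /eqP eF]]] {}allS] := allS.
have {}eF : F = star B B' by [].
pose inS L := has (fun G : {set {set V}} => L \in G) S.
have dropF L : (#|L| < j)%N || (#|L| == j) && ((L \in F) || inS L) ->
    L \notin F -> (#|L| < j)%N || (#|L| == j) && inS L.
  by move=> + /negbTE LF; rewrite LF.
(* Members of a star around [B] have size [#|B| + 1], so a star of another size
   meets no interaction of order [j] and is skipped. *)
have [cB|cB] := eqVneq #|B|.+1 j; last first.
  rewrite addnS; apply: (@unit_approximableW (n + size S)) => //.
  apply: IH => // L /supJ; case/orP => [->//|/andP[/eqP cL]].
  case/orP => [|->]; last by rewrite cL eqxx orbT.
  rewrite eF => /imsetP[i iB' eL]; case/eqP: cB; rewrite -cL eL cardsU1.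
  case: (boolP (i \in B)) => // iB.
  by have := in_set0 i; rewrite -dis !inE iB iB'.
pose J' L := J L *+ (L \notin F).
have split_energy x : set_energy J' x +
    monomial B x * linear_form (fun i => J (i |: B) *+ (i \in B')) x =
    set_energy J x.
  rewrite -set_energy_star // -set_energyD; apply: eq_bigr => L _.
  by rewrite /J' eF; case: (L \in _); rewrite /= ?mulr0n ?mulr1n ?add0r ?addr0.
apply: (eq_unit_approximable split_energy); rewrite addnS.
apply: unit_approximable_peel => c.
apply: (@eq_unit_approximable _ (set_energy (fun L => J' L + c *+ (L == B)))).
  by move=> x; rewrite set_energyD set_energy1.
apply: IH => // L; have [->|LB] := eqVneq L B; first by rewrite -cB ltnSn.
rewrite mulr0n addr0 /J'; case: (boolP (L \in F)) => [|LF].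
  by rewrite mulr0n eqxx.
by rewrite mulr1n => /supJ /dropF; apply.
Qed.

Lemma unit_approximable_affine J :
  (forall L, J L != 0 -> (#|L| <= 1)%N) -> unit_approximable 0 (set_energy J).
Proof.
move=> supJ d d0; exists (fun i => J [set i]), (J set0), [::]; split=> // x.
rewrite big_nil addr0 -[J set0]mulr1.
suff -> : set_energy J x = J set0 * 1 + linear_form (fun i => J [set i]) x.
  by rewrite subrr normr0 ltW.
rewrite /set_energy (bigID (fun L => #|L| <= 1)%N) /= [X in _ + X]big1 ?addr0.
  rewrite (bigD1 set0) ?cards0 //= /monomial big_set0; congr (_ + _).
  rewrite (eq_bigl [in [set [set i] | i in V]]); last first.
    move=> L; rewrite unfold_in /=; apply/idP/imsetP => [/andP[cL L0]|[i _ ->]].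
      have /cards1P[i ->] : #|L| == 1%N by rewrite eqn_leq cL card_gt0.
      by exists i.
    by rewrite cards1 /= -card_gt0 cards1.
  rewrite big_imset /=; last by move=> i l _ _ /set1_inj.
  by apply: eq_bigr => i _; rewrite big_set1.
by move=> L; apply: contraNeq => /eqP h; apply: supJ; apply/eqP => J0;
  case: h; rewrite J0 mul0r.
Qed.

(** Induction starts at [k = 1], where the energy is affine; this is why the sum
    in [star_bound] starts at 2. *)
Lemma unit_approximable_energy k J : (0 < k)%N ->
  (forall L, J L != 0 -> (#|L| <= k)%N) ->
  unit_approximable (star_bound V k) (set_energy J).
Proof.
case: k => // k _; elim: k J => [|k IH] J supJ.
  by rewrite /star_bound big_geq //; exact: unit_approximable_affine.
have [[S /andP[/forall_inP starS /subsetP covS] cS] _] :=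
  star_numberP V (ltn0Sn k.+1).
rewrite /star_bound big_nat_recr //= -cS cardE.
apply: unit_approximable_layer (ltn0Sn k.+1) _ _ _ _ _.
- by move=> J' supJ'; apply: IH => L /supJ'.
- by apply/allP => F; rewrite mem_enum => /starS.
move=> L /supJ; rewrite leq_eqVlt orbC => /orP[->//|cL]; rewrite cL.
have /covS/bigcupP[F FS LF] : L \in layer V k.+2 by rewrite inE.
by apply/orP; right; apply/hasP; exists F; rewrite ?mem_enum.
Qed.

(** * Continuity of normalization *)

Section Gibbs.
Implicit Types E : config V -> R.

Lemma gibbs_denom_gt0 E : 0 < \sum_(y : config V) expR (E y).
Proof.
rewrite (bigD1 [ffun=> false]) //=; apply: ltr_wpDr (expR_gt0 _).
by apply: sumr_ge0 => y _; apply: expR_ge0.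
Qed.

Lemma gibbs_le1 E x : gibbs E x <= 1.
Proof.
rewrite ler_pdivrMr ?gibbs_denom_gt0 // mul1r (bigD1 x) //= lerDl.
by apply: sumr_ge0 => y _; apply: expR_ge0.
Qed.

Lemma eq_gibbs E E' : E =1 E' -> gibbs E =1 gibbs E'.
Proof.
move=> e x; rewrite /gibbs e; congr (_ / _).
by apply: eq_bigr => y _; rewrite e.
Qed.

Lemma gibbs_addr c E x : gibbs (fun y => c + E y) x = gibbs E x.
Proof.
rewrite /gibbs expRD (eq_bigr (fun y => expR c * expR (E y))); last first.
  by move=> y _; rewrite expRD.
by rewrite -mulr_sumr invfM mulrACA divff ?mul1r // gt_eqF ?expR_gt0.
Qed.

(** Both the numerator and the normalizing constant change by a factor at most
    [expR d]. *)
Lemma gibbs_le_dist d E E' : (forall x, `|E x - E' x| <= d) ->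
  forall x, gibbs E x <= expR (2 * d) * gibbs E' x.
Proof.
move=> h x; rewrite /gibbs mulrA ler_pdivrMr ?gibbs_denom_gt0 //.
rewrite mulrAC ler_pdivlMr ?gibbs_denom_gt0 // mulr_sumr mulr_sumr.
apply: ler_sum => y _; rewrite -!expRD ler_expR.
have := h x; have := h y; rewrite !ler_norml => /andP[h1 h2] /andP[h3 h4]; lra.
Qed.

Lemma gibbs_continuous (e : R) : 0 < e -> exists2 d, 0 < d &
  forall E E', (forall x, `|E x - E' x| <= d) ->
  forall x, `|gibbs E x - gibbs E' x| <= e.
Proof.
move=> e0; exists (ln (1 + e) / 2).
  by rewrite divr_gt0 // ln_gt0 // ltrDl.
suff half E E' : (forall x, `|E x - E' x| <= ln (1 + e) / 2) ->
    forall x, gibbs E x - gibbs E' x <= e.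
  move=> E E' h x; rewrite ler_norml lerNl opprB !half // => y.
  by rewrite distrC.
move=> /gibbs_le_dist h x; have {h} := h x.
have -> : 2 * (ln (1 + e) / 2) = ln (1 + e) by field.
rewrite lnK ?posrE ?addr_gt0 // mulrDl mul1r lerBlDl => /le_trans; apply.
by rewrite lerD2l ler_piMr ?gibbs_le1 // ltW.
Qed.
End Gibbs.

(** Surplus units get weight 0, so that they only add a constant. *)
Lemma rbm_approximable (H : finType) (n : nat) E : (n <= #|H|)%N ->
  unit_approximable n E -> approximable (@rbm R V H) (gibbs E).
Proof.
move=> nH aE e e0; have [d d0 close] := gibbs_continuous e0.
have [b [b0 [us [sz h]]]] := aE d d0.
pose u (l : H) := nth (fun=> 0, 0) us (enum_rank l).
exists (gibbs (rbm_energy b (fun l => (u l).1) (fun l => (u l).2))).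
  by exists b, (fun l => (u l).1), (fun l => (u l).2).
apply: bigmax_le => [|x _]; first exact: ltW.
pose pad := \sum_(size us <= l < #|H|) softplus 0.
rewrite -(gibbs_addr (b0 - pad) (rbm_energy _ _ _)); apply: close => y.
suff -> : b0 - pad + rbm_energy b (fun l => (u l).1) (fun l => (u l).2) y =
    b0 + linear_form b y + \sum_(u <- us) hidden_unit u y by apply: h.
have -> : rbm_energy b (fun l => (u l).1) (fun l => (u l).2) y =
    linear_form b y + \sum_(l : H) hidden_unit (u l) y by [].
suff -> : \sum_(l : H) hidden_unit (u l) y =
    \sum_(v <- us) hidden_unit v y + pad by ring.
pose G l := hidden_unit (nth (fun=> 0, 0) us l) y.
rewrite (reindex _ (onW_bij _ (@enum_val_bij H))) /=.
rewrite (eq_bigr (fun i : 'I_#|H| => G i)); last first.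
  by move=> i _; rewrite /u enum_valK.
rewrite -(big_mkord xpredT G).
rewrite (@big_cat_nat _ _ _ (size us)) ?(leq_trans sz) //=.
congr (_ + _); first by rewrite [RHS](big_nth (fun=> 0, 0)).
apply: eq_big_nat => l /andP[ul _]; rewrite /G nth_default // /hidden_unit /=.
by rewrite /linear_form big1 ?addr0 // => i _; rewrite mul0r.
Qed.

Lemma interaction_model_approximable (H : finType) k p : (0 < k)%N ->
  (star_bound V k <= #|H|)%N -> interaction_model k p ->
  approximable (@rbm R V H) p.
Proof.
move=> k0 hH [J eJ].
pose J' L := if (#|L| <= k)%N then J L else 0.
have eE : interaction_energy k J =1 set_energy J'.
  move=> x; rewrite /interaction_energy big_mkcond; apply: eq_bigr => L _.
  by rewrite /J' /monomial; case: ifP; rewrite ?mul0r.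
have aJ : approximable (@rbm R V H) (gibbs (set_energy J')).
  apply: rbm_approximable hH _; apply: unit_approximable_energy => // L.
  by rewrite /J'; case: ifP => // _; rewrite eqxx.
move=> e /aJ[q Mq hq]; exists q => //.
by under eq_bigr do rewrite eJ (eq_gibbs eE).
Qed.
End HiddenUnits.

(** * Bounds on the star number *)

Section GreedyCovering.
Variable R : realType.

Definition harmonic_sum (n : nat) : R := \sum_(0 <= i < n) i.+1%:R^-1.

Lemma harmonic_sum_sub (a b m : nat) : (b <= a)%N -> (a <= m)%N ->
  (a - b)%:R / m%:R <= harmonic_sum a - harmonic_sum b.
Proof.
move=> ba am; rewrite /harmonic_sum (big_cat_nat (leq0n b) ba) /=.
rewrite addrAC subrr add0r.
rewrite mulr_natl -sumr_const_nat; apply: ler_sum_nat => i /andP[_ ia].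
by rewrite lef_pV2 ?posrE ?ltr0n ?ler_nat; lia.
Qed.

Lemma harmonic_sum_le_ln n : (0 < n)%N -> harmonic_sum n <= 1 + ln n%:R.
Proof.
case: n => // n _; elim: n => [|n IH].
  by rewrite /harmonic_sum big_nat1 invr1 ln1 addr0.
rewrite /harmonic_sum big_nat_recr //=; apply: le_trans (lerD IH (lexx _)) _.
rewrite -addrA lerD2l addrC -lerBrDr -lerN2 opprB -ln_div ?posrE ?ltr0n //.
have -> : n.+1%:R / n.+2%:R = 1 - n.+2%:R^-1 :> R.
  have -> : n.+1%:R = n.+2%:R - 1 :> R by rewrite -(natr1 n.+1) addrK.
  by rewrite mulrBl divff ?pnatr_eq0 // mul1r.
by apply: le_ln1Dx; rewrite ltrN2 invf_lt1 ?ltr1n ?ltr0n.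
Qed.

(** The greedy algorithm, analysed with the potential
    [\sum_i harmonic_sum #|E i :&: U|] of the uncovered part [U] of the ground
    set.  If the chosen set [E e] contains the largest number [m] of uncovered
    points, then covering one more point [z] lowers by at least [1 / m] the term
    of each of the at least [r] sets that contain [z].  As [m] points get
    covered, each step lowers the potential by at least [r]. *)
Lemma greedy_cover (T I : finType) (E : I -> {set T}) (r : nat) (U : {set T}) :
  (0 < r)%N -> (forall u, u \in U -> (r <= #|[set i | u \in E i]|)%N) ->
  exists2 S : {set I}, U \subset \bigcup_(i in S) E i &
    #|S|%:R * r%:R <= \sum_i harmonic_sum #|E i :&: U|.
Proof.
move=> r0; have [n] := ubnP #|U|; elim: n U => // n IH U.
rewrite ltnS => Un degU.
have [->|[u uU]] := set_0Vmem U.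
  exists set0; first exact: sub0set.
  rewrite cards0 mul0r sumr_ge0 // => i _.
  by apply: sumr_ge0 => l _; rewrite invr_ge0.
have /card_gt0P[i0 ui0] : (0 < #|[set i | u \in E i]|)%N.
  exact: leq_trans r0 (degU u uU).
rewrite inE in ui0.
pose e := [arg max_(i > i0) #|E i :&: U|]%N.
have maxe i : (#|E i :&: U| <= #|E e :&: U|)%N.
  by rewrite /e; case: arg_maxnP => // m _; apply.
have e_gt0 : (0 < #|E e :&: U|)%N.
  apply: leq_trans (maxe i0); rewrite card_gt0; apply/set0Pn; exists u.
  by rewrite inE ui0.
have [||S covS cS] := IH (U :\: E e).
- apply: leq_trans Un; rewrite -(cardsID (E e) U) setIC -[ltnLHS]add0n.
  by rewrite ltn_add2r.
- by move=> z /setDP[/degU].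
exists (e |: S).
  apply/subsetP => z zU; have [ze|ze] := boolP (z \in E e).
    by apply/bigcupP; exists e; rewrite ?setU11.
  have /(subsetP covS)/bigcupP[i iS zi] : z \in U :\: E e by rewrite inE ze.
  by apply/bigcupP; exists i; rewrite // inE iS orbT.
have card_eS : #|e |: S|%:R * r%:R <= (r + #|S| * r)%:R :> R.
  rewrite -natrM ler_nat -mulSn leq_mul2r cardsU1 -add1n leq_add2r.
  by rewrite leq_b1 orbT.
apply: le_trans card_eS _; rewrite natrD natrM -lerBrDr.
apply: le_trans (_ : _ <= \sum_i harmonic_sum #|E i :&: U| -
  \sum_i harmonic_sum #|E i :&: (U :\: E e)|) _; last by rewrite lerD2l lerN2.
rewrite -sumrB; pose m := #|E e :&: U|.
apply: le_trans (_ : _ <= \sum_i #|E i :&: (U :&: E e)|%:R / m%:R) _.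
  (* Count in two ways the pairs of a set and a newly covered point of it. *)
  rewrite -mulr_suml ler_pdivlMr ?ltr0n // -natrM -natr_sum ler_nat.
  have -> : (\sum_i #|E i :&: (U :&: E e)| =
      \sum_(z in U :&: E e) #|[set i | z \in E i]|)%N.
    rewrite (eq_bigr (fun i => \sum_(z in U :&: E e) (z \in E i))%N).
      rewrite [RHS](eq_bigr (fun z => \sum_i (z \in E i))%N).
        exact: exchange_big.
      move=> z _; rewrite -sum1_card big_mkcond; apply: eq_bigr => i _.
      by rewrite inE; case: (_ \in _).
    move=> i _; rewrite -sum1_card big_mkcond [RHS]big_mkcond.
    by apply: eq_bigr => z _; rewrite !inE; do 3 case: (_ \in _).
  rewrite mulnC /m [E e :&: U]setIC -sum_nat_const.
  by apply: leq_sum => z /setIP[/degU].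
apply: ler_sum => i _.
have -> : #|E i :&: (U :&: E e)| = (#|E i :&: U| - #|E i :&: (U :\: E e)|)%N.
  by rewrite -(cardsID (E e) (E i :&: U)) setIA setIDA addnK.
apply: harmonic_sum_sub (maxe i); apply/subset_leq_card/setIS/subsetDl.
Qed.

Variable V : finType.

Lemma star_tuple_star (B : {set V}) : star_tuple (star B (~: B)).
Proof.
by apply/existsP; exists B; apply/existsP; exists (~: B); rewrite setICr !eqxx.
Qed.

Lemma mem_star (B L : {set V}) i :
  i \in L -> L :\ i = B -> L \in star B (~: B).
Proof.
move=> iL <-; apply/imsetP; exists i; first by rewrite !inE eqxx.
by rewrite setD1K.
Qed.

(** It is enough to name the centres of the stars, each star being taken as
    large as possible. *)
Lemma star_number_le_cover (j : nat) (C : {set {set V}}) : (0 < j)%N ->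
  (forall L : {set V}, #|L| = j -> exists2 i, i \in L & L :\ i \in C) ->
  (star_number V j <= #|C|)%N.
Proof.
move=> j0 covC; have [_ minV] := star_numberP V j0.
apply: leq_trans (leq_imset_card (fun B => star B (~: B)) C).
apply: minV; apply/andP; split.
  by apply/forall_inP => F /imsetP[B _ ->]; exact: star_tuple_star.
apply/subsetP => L; rewrite inE => /eqP /covC[i iL LC].
apply/bigcupP; exists (star (L :\ i) (~: (L :\ i))); last exact: mem_star iL _.
exact: (imset_f (fun B => star B (~: B))).
Qed.

(** The centres are the sets of size [j - 1] that avoid a fixed vertex [v0]: a
    set of size [j] loses [v0] if it contains it, and any element otherwise. *)
Lemma star_number_le_bin (j : nat) : (0 < j <= #|V|)%N ->
  (star_number V j <= 'C(#|V| - 1, j - 1))%N.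
Proof.
case/andP=> j0 jv; have /card_gt0P[v0 _] := leq_trans j0 jv.
have -> : (#|V| - 1 = #|[set~ v0]|)%N by rewrite cardsC1 subn1.
rewrite -cards_draws; apply: star_number_le_cover => // L cL.
have [i iL v0L] : exists2 i, i \in L & v0 \notin L :\ i.
  have [v0L|v0L] := boolP (v0 \in L); first by exists v0; rewrite // !inE eqxx.
  have /card_gt0P[i iL] : (0 < #|L|)%N by rewrite cL.
  by exists i; rewrite // !inE (negbTE v0L) andbF.
exists i; rewrite // inE subsetC sub1set inE v0L.
by rewrite -cL (cardsD1 i L) iL addKn eqxx.
Qed.

(** [greedy_cover] for the stars centred at the sets of size [j - 1]: each set
    of size [j] lies in [j] of them, and each of them has [v - j + 1] members,
    [v] being [#|V|].  Sets of other sizes index an empty star. *)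
Lemma star_number_le_ln (j : nat) : (0 < j <= #|V|)%N ->
  (star_number V j)%:R <=
    (1 + ln (#|V| - j + 1)%:R) / (#|V| - j + 1)%:R * 'C(#|V|, j)%:R :> R.
Proof.
case: j => // j /= jv; set v := #|V| in jv *.
pose d := (v - j)%N; have -> : (v - j.+1 + 1 = d)%N by rewrite addn1 -subSn.
have d0 : (0 < d)%N by rewrite subn_gt0.
pose E (B : {set V}) := if #|B| == j then star B (~: B) else set0.
have deg L : L \in layer V j.+1 -> (j.+1 <= #|[set B | L \in E B]|)%N.
  rewrite inE => /eqP cL; rewrite -{1}cL.
  rewrite -(card_in_imset (f := fun i => L :\ i) (D := L)); last first.
    move=> i l iL lL /setP/(_ i); rewrite !inE eqxx iL /= andbT.
    by case: eqVneq.
  apply/subset_leq_card/subsetP => B /imsetP[i iL eB].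
  have cB : #|B| = j by move: cL; rewrite (cardsD1 i) iL -eB => -[].
  by rewrite inE /E cB eqxx (mem_star iL).
have [S covS cS] := greedy_cover (ltn0Sn j) deg.
have SV : (star_number V j.+1 <= #|S|)%N.
  apply: star_number_le_cover => // L cL.
  have /(subsetP covS)/bigcupP[B BS] : L \in layer V j.+1 by rewrite inE cL.
  rewrite /E; case: eqP => [cB|_]; last by rewrite inE.
  case/imsetP => i; rewrite inE => iB eL; exists i; first by rewrite eL setU11.
  by rewrite eL setU1K.
have total : \sum_B harmonic_sum #|E B :&: layer V j.+1| <=
    'C(v, j)%:R * (1 + ln d%:R).
  rewrite -card_draws mulr_natl -sumr_const [leRHS]big_mkcond.
  apply: ler_sum => B _; rewrite inE /E; case: eqP => [cB|_]; last first.
    by rewrite set0I cards0 /harmonic_sum big_geq.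
  apply: le_trans (harmonic_sum_le_ln d0).
  have le_d : (#|star B (~: B) :&: layer V j.+1| <= d)%N.
    apply: leq_trans (subset_leq_card (subsetIl _ _)) _.
    by apply: leq_trans (leq_imset_card _ _) _; rewrite cardsCs setCK cB.
  rewrite -subr_ge0; apply: le_trans (harmonic_sum_sub le_d (leqnn d)).
  by rewrite divr_ge0.
(* This identity turns the number of centres into the size of the layer. *)
have absorb : j.+1%:R * 'C(v, j.+1)%:R = d%:R * 'C(v, j)%:R :> R.
  by rewrite -!natrM mul_bin_left.
rewrite mulrAC ler_pdivlMr ?ltr0n // -(ler_pM2r (ltr0Sn R j)).
apply: le_trans (_ : _ <= #|S|%:R * j.+1%:R * d%:R) _.
  by rewrite mulrAC ler_wpM2r // ler_wpM2r // ler_nat.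
apply: le_trans (ler_wpM2r _ (le_trans cS total)) _; first by [].
by rewrite -[leRHS]mulrA [X in _ <= _ * X]mulrC absorb; lra.
Qed.

(** Termwise, from the logarithmic bound: [ln (v - j + 1)] is largest for
    [j = 2], and the quotient of the binomial coefficient by [v - j + 1] is
    absorbed into row [v + 1] of Pascal's triangle. *)
Lemma star_bound_le_ln (k : nat) : (2 <= #|V|)%N -> (k <= #|V|)%N ->
  (star_bound V k)%:R <= (ln (#|V| - 1)%:R + 1) / (#|V| + 1)%:R *
    \sum_(2 <= j < k.+1) 'C(#|V| + 1, j)%:R :> R.
Proof.
set v := #|V| => v2 kv; rewrite natr_sum mulr_sumr; apply: ler_sum_nat => j.
case/andP=> j2; rewrite ltnS => jk; have jv := leq_trans jk kv.
apply: le_trans (star_number_le_ln _) _; first by rewrite (ltnW j2).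
rewrite -/v; set d := (v - j + 1)%N.
have d0 : (0 < d)%N by rewrite /d addn1.
have absorb : 'C(v, j)%:R / d%:R = 'C(v + 1, j)%:R / (v + 1)%:R :> R.
  apply/eqP; rewrite eqr_div ?pnatr_eq0 ?addn1 -?lt0n // -!natrM eqr_nat.
  rewrite mulnC (mul_bin_down v.+1 j) mulnC /d addn1 subSn //.
rewrite mulrAC -mulrA absorb [leRHS]mulrAC -mulrA ler_wpM2r ?divr_ge0 //.
rewrite addrC lerD2r ler_ln ?posrE ?ltr0n ?subn_gt0 // ler_nat /d; lia.
Qed.

End GreedyCovering.

Theorem theorem11 (R : realType) (V H : finType) (v k h : nat)
    (hV : #|V| = v) (hH : #|H| = h)
    (v1 : (1 <= v)%N) (k1 : (1 <= k)%N) (kv : (k <= v)%N) :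
  [/\ (star_bound V k <= h)%N ->
        forall p : config V -> R,
          interaction_model k p -> approximable (@rbm R V H) p,
      forall j : nat, (0 < j <= v)%N ->
        (star_number V j)%:R <=
          (1 + ln (v - j + 1)%:R) / (v - j + 1)%:R * 'C(v, j)%:R :> R,
      forall j : nat, (0 < j <= v)%N ->
        (star_number V j <= 'C(v - 1, j - 1))%N,
      (\sum_(2 <= j < k.+1) 'C(v - 1, j - 1) <= h)%N ->
        forall p : config V -> R,
          interaction_model k p -> approximable (@rbm R V H) p
    & (2 <= v)%N ->
      (ln (v - 1)%:R + 1) / (v + 1)%:R * \sum_(2 <= j < k.+1) 'C(v + 1, j)%:R
        <= h%:R :> R ->
        forall p : config V -> R,
          interaction_model k p -> approximable (@rbm R V H) p].
Proof.
subst v h.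
have byCount n : (star_bound V k <= n)%N -> (n <= #|H|)%N ->
    forall p : config V -> R,
      interaction_model k p -> approximable (@rbm R V H) p.
  move=> Un nH p; apply: interaction_model_approximable k1 _.
  exact: leq_trans Un nH.
split.
- by move=> hU; apply: byCount hU.
- by move=> j jv; apply: star_number_le_ln.
- by move=> j jv; apply: star_number_le_bin.
- apply: byCount; rewrite /star_bound big_nat_cond [leqRHS]big_nat_cond.
  apply: leq_sum => j /andP[/andP[j2 jk] _].
  by apply: star_number_le_bin; lia.
- move=> v2 hU; apply: (byCount _ (leqnn _)); rewrite -(ler_nat R).
  exact: le_trans (star_bound_le_ln _ v2 kv) hU.
Qed.
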